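(* Let $f,g$ be real functions on $[0,\infty)$, differentiable at $0$, with $f'(0)>0$ and $g'(0)>0$. Consider the eigenvalue problem $$-\phi''+\phi=0,\quad -\psi''+\psi=0\quad\text{in }(0,1),$$ $$-\phi'(0)-\lambda f'(0)\psi(0)=0,\quad \phi'(1)-\lambda f'(0)\psi(1)=0,\quad -\psi'(0)-\lambda g'(0)\phi(0)=0,\quad \psi'(1)-\lambda g'(0)\phi(1)=0 .$$ Its principal eigenvalue $\lambda_1$ (the smallest positive $\lambda$ for which a nontrivial solution $(\phi,\psi)$ exists) exists, is the smallest positive solution of $$[f'(0)g'(0)]^2\lambda^4+\left(2-\frac{4}{\tanh^2(1)}\right)f'(0)g'(0)\lambda^2+1=0,$$ and satisfies $$0<\lambda_1<\sqrt{\frac{\frac{2}{\tanh^2(1)}-1}{f'(0)g'(0)}} .$$ Moreover, for any constant $A>0$, the corresponding eigenfunction pair $$\phi(x)=A\left(\cosh(x)-\tfrac12\big(1+\lambda_1^2f'(0)g'(0)\big)\tanh(1)\sinh(x)\right),$$ $$\psi(x)=A\left(\frac{1+\lambda_1^2f'(0)g'(0)}{2\lambda_1f'(0)}\tanh(1)\cosh(x)-\lambda_1g'(0)\sinh(x)\right)$$ satisfies $\phi(x)>0$ and $\psi(x)>0$ for all $x\in(0,1)$.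
   Context: The problem is the linearization at the trivial solution of the one-dimensional coupled system $-u''+u=0$, $-v''+v=0$ in $(0,1)$ with outward normal derivatives of $u$ and $v$ equal to $\lambda f(v)$ and $\lambda g(u)$ respectively at $x=0$ and $x=1$, where $f(0)=g(0)=0$. Only the numbers $f'(0)>0$ and $g'(0)>0$ enter. *)

(* Defs.v *)
From Stdlib Require Import Reals.
From Coquelicot Require Import Coquelicot.

Local Open Scope R_scope.

(* [l] is the derivative of [h] at [x] relative to the domain [D]: only the
   values of [h] on [D] (and at [x]) matter, so the derivative is one-sided at an
   endpoint of an interval [D]. *)
Definition is_derive_on (D : R -> Prop) (h : R -> R) (x l : R) : Prop :=
  filterlim (fun y => (h y - h x) / (y - x)) (within D (locally' x)) (locally l).

(* Classical solutions. [dphi], [dpsi] are phi', psi' on [0,1], one-sided at 0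
   and 1. No continuity of phi' up to the boundary is asked for: it follows from
   the equation and the one-sided differentiability. [a], [b] are f'(0), g'(0). *)
Definition solves_linearized (a b lambda : R) (phi psi : R -> R) : Prop :=
  exists dphi dpsi : R -> R,
    (forall x, 0 <= x <= 1 -> is_derive_on (fun y => 0 <= y <= 1) phi x (dphi x)) /\
    (forall x, 0 <= x <= 1 -> is_derive_on (fun y => 0 <= y <= 1) psi x (dpsi x)) /\
    (forall x, 0 < x < 1 -> ex_derive dphi x /\ - Derive dphi x + phi x = 0) /\
    (forall x, 0 < x < 1 -> ex_derive dpsi x /\ - Derive dpsi x + psi x = 0) /\
    - dphi 0 - lambda * a * psi 0 = 0 /\
    dphi 1 - lambda * a * psi 1 = 0 /\
    - dpsi 0 - lambda * b * phi 0 = 0 /\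
    dpsi 1 - lambda * b * phi 1 = 0.

Definition is_eigenpair (a b lambda : R) (phi psi : R -> R) : Prop :=
  solves_linearized a b lambda phi psi /\
  exists x, 0 <= x <= 1 /\ (phi x <> 0 \/ psi x <> 0).

Definition is_eigenvalue (a b lambda : R) : Prop :=
  exists phi psi : R -> R, is_eigenpair a b lambda phi psi.

Definition is_smallest_positive (P : R -> Prop) (x : R) : Prop :=
  0 < x /\ P x /\ forall y, 0 < y -> P y -> x <= y.

Definition is_principal_eigenvalue (a b : R) : R -> Prop :=
  is_smallest_positive (is_eigenvalue a b).

(* Main.v *)
Require Import Defs.
From Stdlib Require Import Reals Lra.
From Coquelicot Require Import Coquelicot.

Local Open Scope R_scope.

(** Write [a], [b] for the derivatives of [f], [g] at 0. Every solution of
    -u'' + u = 0 is a combination of [cosh] and [sinh] ([solution_cosh_sinh]),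
    so the problem reduces to four linear equations for four coefficients.
    Eliminating the [sinh] coefficients leaves a 2 by 2 system whose determinant
    vanishes exactly when
    [(tanh 1 * (1 + k)) ^ 2 = 4 * k], where [k = lambda ^ 2 * a * b].
    Clearing denominators, this is the quartic, so an eigenvalue solves it
    ([eigenvalue_quartic]) and a positive solution is an eigenvalue, with the
    stated pair as eigenfunctions ([quartic_eigenpair]).

    The quartic is palindromic in [k], and its roots are [m ^ 2] and [/ m ^ 2]
    with [m = tanh (1 / 2)], by the double-angle formula. The least positive
    solution is therefore [lambda1 = m / sqrt (a * b)] ([quartic_root_ge]). The
    upper bound follows from [m ^ 2 < 1 < 2 / tanh 1 ^ 2 - 1]. At [lambda1] both
    eigenfunctions are positive multiples of [cosh x - m * sinh x], which is
    positive because [m < 1] and [sinh x < cosh x]. *)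

(** * Relative derivatives *)

Lemma is_derive_on_of_is_derive (D : R -> Prop) (h : R -> R) (x l : R) :
  is_derive h x l -> is_derive_on D h x l.
Proof.
  intros Hd. apply is_derive_Reals in Hd.
  apply filterlim_locally. intros eps.
  destruct (Hd eps (cond_pos eps)) as [delta Hdelta].
  exists delta. intros y Hy Hyx _.
  specialize (Hdelta (y - x) ltac:(lra) Hy).
  now rewrite Rplus_minus in Hdelta.
Qed.

Lemma is_derive_of_is_derive_on (D : R -> Prop) (h : R -> R) (x l : R) :
  locally x D -> is_derive_on D h x l -> is_derive h x l.
Proof.
  intros [d HD] Hd. apply is_derive_Reals. intros eps Heps.
  destruct (proj1 (filterlim_locally _ _) Hd (mkposreal eps Heps))
    as [delta Hdelta].
  assert (Hmin : 0 < Rmin d delta) by (apply Rmin_pos; apply cond_pos).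
  exists (mkposreal _ Hmin). simpl. intros t Ht Htd.
  assert (Habs : Rabs ((x + t) - x) < Rmin d delta)
    by now replace ((x + t) - x) with t by ring.
  assert (Hball : Rabs ((h (x + t) - h x) / ((x + t) - x) - l) < eps).
  { apply (Hdelta (x + t)).
    - eapply Rlt_le_trans; [exact Habs | apply Rmin_r].
    - lra.
    - apply HD. eapply Rlt_le_trans; [exact Habs | apply Rmin_l]. }
  now replace (x + t - x) with t in Hball by ring.
Qed.

Lemma is_derive_on_subset (D D' : R -> Prop) (h : R -> R) (x l : R) :
  (forall y, D' y -> D y) -> is_derive_on D h x l -> is_derive_on D' h x l.
Proof.
  intros Hsub Hd P HP. generalize (Hd P HP).
  unfold filtermap, within. apply filter_imp. auto.
Qed.

(** A difference quotient with a limit forces the increment to tend to zero. *)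
Lemma is_derive_on_continuous (D : R -> Prop) (h : R -> R) (x l : R) :
  is_derive_on D h x l ->
  filterlim h (within D (locally' x)) (locally (h x)).
Proof.
  intros Hd.
  assert (Hid : filterlim (fun y : R => y - x) (within D (locally' x))
                  (locally 0)).
  { apply filterlim_locally. intros eps. exists eps. intros y Hy _ _.
    unfold ball in *; simpl in *. unfold AbsRing_ball, abs, minus, plus, opp in *.
    simpl in *. now replace (y - x + - 0) with (y + - x) by ring. }
  assert (Hlim : filterlim
            (fun y => plus (h x) (mult ((h y - h x) / (y - x)) (y - x)))
            (within D (locally' x)) (locally (plus (h x) (mult l 0)))).
  { eapply filterlim_comp_2;
      [apply filterlim_const | | apply (filterlim_plus (V := R_NormedModule))].
    eapply filterlim_comp_2;
      [exact Hd | exact Hid | apply (filterlim_mult (K := R_AbsRing))]. }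
  replace (plus (h x) (mult l 0)) with (h x) in Hlim
    by (unfold plus, mult; simpl; ring).
  revert Hlim. apply filterlim_ext_loc.
  exists (mkposreal 1 Rlt_0_1). intros y _ Hyx _.
  unfold plus, mult; simpl. field. lra.
Qed.

(** The set [D] need not contain the base point [x], so this determines the
    value and the one-sided derivative at an endpoint from interior values. *)
Lemma is_derive_on_unique (D : R -> Prop) (u w : R -> R) (x l l' : R) :
  ProperFilter (within D (locally' x)) ->
  (forall y, D y -> u y = w y) ->
  is_derive_on D u x l -> is_derive_on D w x l' ->
  u x = w x /\ l = l'.
Proof.
  intros HF Heq Hu Hw.
  assert (Hon : within D (locally' x) D)
    by (exists (mkposreal 1 Rlt_0_1); auto).
  assert (Hx : u x = w x).
  { apply (filterlim_locally_unique (K := R_AbsRing) (V := R_NormedModule)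
             (F := within D (locally' x)) w).
    - apply (filterlim_ext_loc u); [ | now apply is_derive_on_continuous with l].
      revert Hon. now apply filter_imp.
    - now apply is_derive_on_continuous with l'. }
  split; [exact Hx | ].
  apply (filterlim_locally_unique (K := R_AbsRing) (V := R_NormedModule)
           (F := within D (locally' x)) (fun y => (w y - w x) / (y - x)));
    [ | exact Hw].
  apply (filterlim_ext_loc (fun y => (u y - u x) / (y - x))); [ | exact Hu].
  revert Hon. apply filter_imp. intros y Hy. now rewrite Hx, Heq.
Qed.

Lemma proper_within_open_unit (x : R) :
  0 <= x <= 1 -> ProperFilter (within (fun y => 0 < y < 1) (locally' x)).
Proof.
  intros Hx. split; [ | typeclasses eauto].
  intros P [d HP].
  pose proof (cond_pos d) as Hd.
  set (e := Rmin (d / 2) (1 / 4)).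
  assert (He : 0 < e) by (apply Rmin_pos; lra).
  assert (Hed : e <= d / 2) by apply Rmin_l.
  assert (He4 : e <= 1 / 4) by apply Rmin_r.
  (* A step of length [e] towards the midpoint stays inside the interval. *)
  destruct (Rle_dec x (1 / 2)) as [Hle | Hgt].
  - exists (x + e). apply HP; try lra.
    change (Rabs (x + e - x) < d). rewrite Rabs_pos_eq; lra.
  - exists (x - e). apply HP; try lra.
    change (Rabs (x - e - x) < d). rewrite Rabs_left; lra.
Qed.

(** * The equation -u'' + u = 0 on the unit interval *)

Lemma cosh2_sinh2 (x : R) : cosh x * cosh x - sinh x * sinh x = 1.
Proof.
  unfold cosh, sinh.
  assert (He : exp x * exp (- x) = 1)
    by (rewrite <- exp_plus, Rplus_opp_r; apply exp_0).
  nra.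
Qed.

Lemma is_derive_cosh_sinh (h : R -> R) (p q x : R) :
  (forall t, h t = p * cosh t + q * sinh t) ->
  is_derive h x (p * sinh x + q * cosh x).
Proof.
  intros Hh.
  apply (is_derive_ext (fun y => p * cosh y + q * sinh y)); [easy | ].
  apply is_derive_Reals.
  apply derivable_pt_lim_plus; apply derivable_pt_lim_scal.
  - apply derivable_pt_lim_cosh.
  - apply derivable_pt_lim_sinh.
Qed.

Lemma constant_on_open (h : R -> R) (a b x y : R) :
  (forall t, a < t < b -> is_derive h t 0) ->
  a < x < b -> a < y < b -> h x = h y.
Proof.
  intros Hd Hx Hy.
  destruct (Rtotal_order x y) as [Hlt | [Heq | Hgt]].
  - apply (eq_is_derive (V := R_NormedModule)); [ | exact Hlt].
    intros t Ht. apply Hd. lra.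
  - now rewrite Heq.
  - symmetry. apply (eq_is_derive (V := R_NormedModule)); [ | exact Hgt].
    intros t Ht. apply Hd. lra.
Qed.

(** Variation of constants: [u cosh - u' sinh] and [u' cosh - u sinh] have zero
    derivative on the open interval, and inverting this unimodular system there
    gives [u] and [u']. One-sided differentiability carries both formulas to
    the endpoints, where the boundary conditions live. *)
Lemma solution_cosh_sinh (u du : R -> R) :
  (forall x, 0 <= x <= 1 -> is_derive_on (fun y => 0 <= y <= 1) u x (du x)) ->
  (forall x, 0 < x < 1 -> ex_derive du x /\ - Derive du x + u x = 0) ->
  exists p q, forall x, 0 <= x <= 1 ->
    u x = p * cosh x + q * sinh x /\ du x = p * sinh x + q * cosh x.
Proof.
  intros Hu Hdu.
  assert (Hu' : forall x, 0 < x < 1 -> derivable_pt_lim u x (du x)).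
  { intros x Hx. apply is_derive_Reals.
    apply is_derive_of_is_derive_on with (fun y => 0 <= y <= 1);
      [ | apply Hu; lra].
    apply (locally_interval _ x 0 1); simpl; intros; lra. }
  assert (Hdu' : forall x, 0 < x < 1 -> derivable_pt_lim du x (u x)).
  { intros x Hx. apply is_derive_Reals. destruct (Hdu x Hx) as [Hex Heq].
    replace (u x) with (Derive du x) by lra. now apply Derive_correct. }
  set (P := fun x => u x * cosh x - du x * sinh x).
  set (Q := fun x => du x * cosh x - u x * sinh x).
  assert (HP : forall x, 0 < x < 1 -> is_derive P x 0).
  { intros x Hx. apply is_derive_Reals.
    replace 0 with ((du x * cosh x + u x * sinh x)
                    - (u x * sinh x + du x * cosh x)) by ring.
    apply derivable_pt_lim_minus; apply derivable_pt_lim_mult;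
      auto using derivable_pt_lim_cosh, derivable_pt_lim_sinh. }
  assert (HQ : forall x, 0 < x < 1 -> is_derive Q x 0).
  { intros x Hx. apply is_derive_Reals.
    replace 0 with ((u x * cosh x + du x * sinh x)
                    - (du x * sinh x + u x * cosh x)) by ring.
    apply derivable_pt_lim_minus; apply derivable_pt_lim_mult;
      auto using derivable_pt_lim_cosh, derivable_pt_lim_sinh. }
  exists (P (1 / 2)), (Q (1 / 2)). intros x Hx.
  apply is_derive_on_unique
    with (D := fun y => 0 < y < 1)
         (w := fun y => P (1 / 2) * cosh y + Q (1 / 2) * sinh y).
  - now apply proper_within_open_unit.
  - intros y Hy.
    rewrite <- (constant_on_open P 0 1 y (1 / 2) HP Hy) by lra.
    rewrite <- (constant_on_open Q 0 1 y (1 / 2) HQ Hy) by lra.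
    unfold P, Q.
    transitivity (u y * (cosh y * cosh y - sinh y * sinh y)); [ | ring].
    rewrite cosh2_sinh2. ring.
  - apply is_derive_on_subset with (fun y => 0 <= y <= 1);
      [intros; lra | now apply Hu].
  - now apply is_derive_on_of_is_derive, is_derive_cosh_sinh.
Qed.

(** * The characteristic equation *)

Lemma sinh_1_pos : 0 < sinh 1.
Proof. rewrite <- sinh_0. apply sinh_lt. lra. Qed.

Lemma cosh_pos (x : R) : 0 < cosh x.
Proof. unfold cosh. pose proof (exp_pos x). pose proof (exp_pos (- x)). lra. Qed.

Lemma sinh_lt_cosh (x : R) : sinh x < cosh x.
Proof. unfold cosh, sinh. pose proof (exp_pos (- x)). lra. Qed.

(** The quartic equation with the denominator of [tanh] cleared; the unknown is
    [k = lambda ^ 2 * a * b]. *)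
Lemma quartic_iff (a b lambda : R) :
  (a * b) ^ 2 * lambda ^ 4 + (2 - 4 / tanh 1 ^ 2) * (a * b) * lambda ^ 2 + 1 = 0
  <-> (sinh 1 * (1 + lambda ^ 2 * a * b)) ^ 2
      = 4 * (lambda ^ 2 * a * b) * cosh 1 ^ 2.
Proof.
  pose proof sinh_1_pos as HS. pose proof (cosh_pos 1) as HC.
  assert (E : (a * b) ^ 2 * lambda ^ 4
              + (2 - 4 / tanh 1 ^ 2) * (a * b) * lambda ^ 2 + 1
              = ((sinh 1 * (1 + lambda ^ 2 * a * b)) ^ 2
                 - 4 * (lambda ^ 2 * a * b) * cosh 1 ^ 2) / sinh 1 ^ 2).
  { unfold tanh. field. lra. }
  rewrite E. split; intros H.
  - apply Rmult_integral in H. destruct H as [H | H]; [lra | ].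
    exfalso. revert H. apply Rinv_neq_0_compat, pow_nonzero. lra.
  - rewrite H. unfold Rdiv. ring.
Qed.

(** The conditions at 0 express the [sinh] coefficients through the [cosh]
    coefficients [p], [r]; those at 1 then read [p S (1 + k) = 2 lambda a r C]
    and [r S (1 + k) = 2 lambda b p C], with [S = sinh 1], [C = cosh 1] and
    [k = lambda ^ 2 * a * b]. This linear system in [p], [r] is singular exactly
    when the quartic holds. *)
Lemma eigenvalue_quartic (a b lambda : R) :
  is_eigenvalue a b lambda ->
  (sinh 1 * (1 + lambda ^ 2 * a * b)) ^ 2
  = 4 * (lambda ^ 2 * a * b) * cosh 1 ^ 2.
Proof.
  intros [phi [psi [[dphi [dpsi [H1 [H2 [H3 [H4 [B1 [B2 [B3 B4]]]]]]]]]
                    [x [Hx Hnz]]]]].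
  destruct (solution_cosh_sinh phi dphi H1 H3) as [p [q Hphi]].
  destruct (solution_cosh_sinh psi dpsi H2 H4) as [r [s Hpsi]].
  destruct (Hphi 0 ltac:(lra)) as [P0 P0']. destruct (Hphi 1 ltac:(lra)) as [P1 P1'].
  destruct (Hpsi 0 ltac:(lra)) as [R0 R0']. destruct (Hpsi 1 ltac:(lra)) as [R1 R1'].
  rewrite sinh_0, cosh_0 in *.
  assert (Hq : q = - (lambda * a * r)) by (rewrite R0, P0' in B1; lra).
  assert (Hs : s = - (lambda * b * p)) by (rewrite P0, R0' in B3; lra).
  rewrite P1', R1 in B2. rewrite R1', P1 in B4.
  set (k := lambda ^ 2 * a * b) in *.
  assert (E1 : p * (sinh 1 * (1 + k)) = 2 * (lambda * a) * r * cosh 1).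
  { unfold k. subst q s. lra. }
  assert (E2 : r * (sinh 1 * (1 + k)) = 2 * (lambda * b) * p * cosh 1).
  { unfold k. subst q s. lra. }
  set (W := sinh 1 * (1 + k)) in *.
  (* The determinant annihilates both unknowns. *)
  assert (Dp : p * (W ^ 2 - 4 * k * cosh 1 ^ 2) = 0).
  { transitivity (W * (p * W) - 4 * k * cosh 1 ^ 2 * p); [ring | rewrite E1].
    transitivity (2 * (lambda * a) * cosh 1 * (r * W) - 4 * k * cosh 1 ^ 2 * p);
      [ring | rewrite E2; unfold k; ring]. }
  assert (Dr : r * (W ^ 2 - 4 * k * cosh 1 ^ 2) = 0).
  { transitivity (W * (r * W) - 4 * k * cosh 1 ^ 2 * r); [ring | rewrite E2].
    transitivity (2 * (lambda * b) * cosh 1 * (p * W) - 4 * k * cosh 1 ^ 2 * r);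
      [ring | rewrite E1; unfold k; ring]. }
  destruct (Req_dec (W ^ 2 - 4 * k * cosh 1 ^ 2) 0) as [Hz | Hne]; [lra | ].
  exfalso.
  apply Rmult_integral in Dp. apply Rmult_integral in Dr.
  assert (Hp : p = 0) by tauto. assert (Hr : r = 0) by tauto.
  destruct (Hphi x Hx) as [Ex _]. destruct (Hpsi x Hx) as [Fx _].
  subst q s. rewrite Hp, Hr in Ex, Fx.
  destruct Hnz as [Hnz | Hnz]; apply Hnz; [rewrite Ex | rewrite Fx]; ring.
Qed.

(** Three of the four boundary conditions hold for every positive [lambda]; the one
    for [psi] at 1 is the quartic equation. *)
Lemma quartic_eigenpair (a b lambda A : R) :
  0 < a -> 0 < lambda -> 0 < A ->
  (sinh 1 * (1 + lambda ^ 2 * a * b)) ^ 2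
  = 4 * (lambda ^ 2 * a * b) * cosh 1 ^ 2 ->
  is_eigenpair a b lambda
    (fun x => A * (cosh x
                   - 1 / 2 * (1 + lambda ^ 2 * a * b) * tanh 1 * sinh x))
    (fun x => A * ((1 + lambda ^ 2 * a * b) / (2 * lambda * a) * tanh 1 * cosh x
                   - lambda * b * sinh x)).
Proof.
  intros Ha Hl HA Hq. pose proof (cosh_pos 1) as HC.
  set (k := lambda ^ 2 * a * b) in *.
  set (q := - (A * (1 / 2 * (1 + k) * tanh 1))).
  set (r := A * ((1 + k) / (2 * lambda * a) * tanh 1)).
  set (s := - (A * (lambda * b))).
  assert (Dphi : forall x,
    is_derive (fun x => A * (cosh x - 1 / 2 * (1 + k) * tanh 1 * sinh x)) x
      (A * sinh x + q * cosh x)).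
  { intros x. apply is_derive_cosh_sinh. intros t. unfold q; ring. }
  assert (Dpsi : forall x,
    is_derive (fun x => A * ((1 + k) / (2 * lambda * a) * tanh 1 * cosh x
                             - lambda * b * sinh x)) x
      (r * sinh x + s * cosh x)).
  { intros x. apply is_derive_cosh_sinh. intros t. unfold r, s; ring. }
  assert (D2 : forall p' q' x,
    is_derive (fun y : R => p' * sinh y + q' * cosh y) x
      (q' * sinh x + p' * cosh x)).
  { intros p' q' x.
    apply is_derive_cosh_sinh. intros t. ring. }
  split.
  - exists (fun x => A * sinh x + q * cosh x), (fun x => r * sinh x + s * cosh x).
    repeat split.
    + intros x _. now apply is_derive_on_of_is_derive.
    + intros x _. now apply is_derive_on_of_is_derive.
    + eexists. apply D2.
    + rewrite (is_derive_unique (fun y : R => _) _ _ (D2 A q x)). unfold q. ring.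
    + eexists. apply D2.
    + rewrite (is_derive_unique (fun y : R => _) _ _ (D2 r s x)). unfold r, s. ring.
    + rewrite sinh_0, cosh_0. unfold q. field. lra.
    + unfold q, tanh, k. field. lra.
    + rewrite sinh_0, cosh_0. unfold s. ring.
    + transitivity (A * ((sinh 1 * (1 + k)) ^ 2 - 4 * k * cosh 1 ^ 2)
                    / (2 * lambda * a * cosh 1)).
      * unfold r, s, tanh, k. field. lra.
      * rewrite Hq. field. lra.
  - exists 0. split; [lra | left]. rewrite sinh_0, cosh_0. lra.
Qed.

(** * The principal eigenvalue *)

(** [(cosh 1 - 1) / sinh 1] is the hyperbolic tangent of 1/2; by the
    double-angle formula it solves [tanh 1 * (1 + m ^ 2) = 2 * m], the square
    root of the quartic equation. *)
Definition tanh_half : R := (cosh 1 - 1) / sinh 1.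

Lemma tanh_half_bounds : 0 < tanh_half < 1.
Proof.
  pose proof sinh_1_pos as HS. pose proof (cosh_pos 1) as HC.
  pose proof (cosh2_sinh2 1) as H1.
  assert (Hgt : 1 < cosh 1).
  { assert (0 < sinh 1 * sinh 1) by now apply Rmult_lt_0_compat.
    destruct (Rlt_or_le 1 (cosh 1)) as [Hlt | Hle]; [exact Hlt | nra]. }
  unfold tanh_half. split.
  - apply Rdiv_lt_0_compat; lra.
  - apply Rlt_div_l; nra.
Qed.

Lemma tanh_half_double : sinh 1 * (1 + tanh_half ^ 2) = 2 * tanh_half * cosh 1.
Proof.
  pose proof sinh_1_pos as HS. pose proof (cosh2_sinh2 1) as H1.
  unfold tanh_half.
  apply (Rmult_eq_reg_r (sinh 1)); [ | lra].
  transitivity (sinh 1 * sinh 1 + (cosh 1 - 1) ^ 2); [field; lra | ].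
  transitivity (2 * (cosh 1 - 1) * cosh 1); [nra | field; lra].
Qed.

(** The quadratic in [k] is palindromic, with roots [m ^ 2 < 1 < / m ^ 2] for
    [m = tanh_half]; below [m ^ 2] it is positive. *)
Lemma quartic_root_ge (k : R) :
  (sinh 1 * (1 + k)) ^ 2 = 4 * k * cosh 1 ^ 2 -> tanh_half ^ 2 <= k.
Proof.
  intros Hk. pose proof tanh_half_bounds as Hm.
  pose proof tanh_half_double as Hd. pose proof sinh_1_pos as HS.
  set (m := tanh_half) in *.
  assert (E : sinh 1 ^ 2 * ((k - m ^ 2) * (m ^ 2 * k - 1)) = 0).
  { transitivity (m ^ 2 * (sinh 1 * (1 + k)) ^ 2
                  - k * (sinh 1 * (1 + m ^ 2)) ^ 2); [ring | ].
    rewrite Hk, Hd. ring. }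
  destruct (Rle_or_lt (m ^ 2) k) as [H | H]; [exact H | exfalso].
  assert (0 < m ^ 2 < 1) by nra.
  assert (m ^ 2 * k < 1) by nra.
  assert (0 < (m ^ 2 - k) * (1 - m ^ 2 * k)) by (apply Rmult_lt_0_compat; lra).
  assert (0 < sinh 1 ^ 2) by (apply pow_lt; exact HS).
  nra.
Qed.

Theorem mainTheorem7 (f g : R -> R) (df0 dg0 : R)
  (hf : is_derive_on (fun y => 0 <= y) f 0 df0)
  (hg : is_derive_on (fun y => 0 <= y) g 0 dg0)
  (hdf0 : 0 < df0) (hdg0 : 0 < dg0) :
  exists lambda1 : R,
    is_principal_eigenvalue df0 dg0 lambda1 /\
    is_smallest_positive
      (fun lambda =>
         (df0 * dg0) ^ 2 * lambda ^ 4
         + (2 - 4 / tanh 1 ^ 2) * (df0 * dg0) * lambda ^ 2 + 1 = 0)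
      lambda1 /\
    0 < lambda1 < sqrt ((2 / tanh 1 ^ 2 - 1) / (df0 * dg0)) /\
    forall A : R, 0 < A ->
      let phi := fun x =>
        A * (cosh x
             - 1 / 2 * (1 + lambda1 ^ 2 * df0 * dg0) * tanh 1 * sinh x) in
      let psi := fun x =>
        A * ((1 + lambda1 ^ 2 * df0 * dg0) / (2 * lambda1 * df0)
             * tanh 1 * cosh x
             - lambda1 * dg0 * sinh x) in
      is_eigenpair df0 dg0 lambda1 phi psi /\
      forall x, 0 < x < 1 -> 0 < phi x /\ 0 < psi x.
Proof.
  set (c := sqrt (df0 * dg0)).
  assert (Hab : 0 < df0 * dg0) by now apply Rmult_lt_0_compat.
  assert (Hc : 0 < c) by now apply sqrt_lt_R0.
  assert (Hc2 : c * c = df0 * dg0) by (apply sqrt_sqrt; lra).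
  pose proof tanh_half_bounds as Hm. pose proof tanh_half_double as Hd.
  pose proof sinh_1_pos as HS. pose proof (cosh_pos 1) as HC.
  pose proof (sinh_lt_cosh 1) as HSC.
  set (m := tanh_half) in *.
  set (l1 := m / c).
  assert (Hl : 0 < l1) by (apply Rdiv_lt_0_compat; lra).
  assert (Hlc : l1 * c = m) by (unfold l1; field; lra).
  assert (Hk : l1 ^ 2 * df0 * dg0 = m ^ 2).
  { rewrite <- Hlc. transitivity (l1 ^ 2 * (df0 * dg0)); [ring | ].
    rewrite <- Hc2. ring. }
  assert (Hquartic : (sinh 1 * (1 + l1 ^ 2 * df0 * dg0)) ^ 2
                     = 4 * (l1 ^ 2 * df0 * dg0) * cosh 1 ^ 2).
  { rewrite Hk, Hd. ring. }
  assert (Hleast : forall y, 0 < y ->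
            (sinh 1 * (1 + y ^ 2 * df0 * dg0)) ^ 2
            = 4 * (y ^ 2 * df0 * dg0) * cosh 1 ^ 2 -> l1 <= y).
  { intros y Hy Hq. apply quartic_root_ge in Hq. fold m in Hq.
    rewrite <- Hk in Hq.
    assert (Hsq : l1 ^ 2 <= y ^ 2) by (apply (Rmult_le_reg_r (df0 * dg0)); lra).
    nra. }
  exists l1. split; [ | split; [ | split]].
  - split; [exact Hl | split].
    + do 2 eexists. apply quartic_eigenpair with (A := 1); auto; lra.
    + intros y Hy Hev. apply Hleast; [exact Hy | now apply eigenvalue_quartic].
  - split; [exact Hl | split].
    + now apply quartic_iff.
    + intros y Hy Hq. apply Hleast; [exact Hy | now apply quartic_iff].
  - split; [exact Hl | ].
    (* Squaring and multiplying by [df0 * dg0] turns the bound into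
       [m ^ 2 < 2 / tanh 1 ^ 2 - 1], whose sides are separated by 1. *)
    rewrite <- (sqrt_pow2 l1) by lra.
    apply sqrt_lt_1_alt. split; [apply pow2_ge_0 | ].
    apply (proj1 (Rlt_div_r _ _ _ Hab)).
    replace (l1 ^ 2 * (df0 * dg0)) with (m ^ 2) by (rewrite <- Hk; ring).
    assert (HT : 1 < / tanh 1 ^ 2).
    { assert (0 < tanh 1) by now apply Rdiv_lt_0_compat.
      assert (tanh 1 < 1) by (unfold tanh; apply Rlt_div_l; lra).
      rewrite <- Rinv_1 at 1. apply Rinv_lt_contravar; nra. }
    unfold Rdiv. nra.
  - intros A HA phi psi. split; [now apply quartic_eigenpair | ].
    (* Both coefficients collapse: with [tanh 1 * (1 + m ^ 2) = 2 * m] the pair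
       is proportional to [cosh x - m * sinh x]. *)
    assert (HTm : (1 + l1 ^ 2 * df0 * dg0) * tanh 1 = 2 * m).
    { rewrite Hk. unfold tanh.
      transitivity (sinh 1 * (1 + m ^ 2) / cosh 1); [field; lra | ].
      rewrite Hd. field. lra. }
    intros x Hx.
    assert (Hpos : 0 < cosh x - m * sinh x).
    { pose proof (sinh_lt_cosh x). pose proof (cosh_pos x).
      assert (0 < sinh x) by (rewrite <- sinh_0; apply sinh_lt; lra). nra. }
    split.
    + unfold phi. apply Rmult_lt_0_compat; [exact HA | ].
      replace (1 / 2 * (1 + l1 ^ 2 * df0 * dg0) * tanh 1)
        with (1 / 2 * ((1 + l1 ^ 2 * df0 * dg0) * tanh 1)) by ring.
      rewrite HTm. lra.
    + unfold psi. apply Rmult_lt_0_compat; [exact HA | ].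
      replace ((1 + l1 ^ 2 * df0 * dg0) / (2 * l1 * df0) * tanh 1)
        with ((1 + l1 ^ 2 * df0 * dg0) * tanh 1 / (2 * l1 * df0))
        by (field; lra).
      rewrite HTm.
      replace (2 * m / (2 * l1 * df0)) with (c / df0)
        by (rewrite <- Hlc; field; lra).
      replace (l1 * dg0) with (c / df0 * m)
        by (rewrite <- Hlc;
            transitivity (l1 * (c * c) / df0); [field; lra | ];
            rewrite Hc2; field; lra).
      replace (c / df0 * cosh x - c / df0 * m * sinh x)
        with (c / df0 * (cosh x - m * sinh x)) by ring.
      apply Rmult_lt_0_compat; [now apply Rdiv_lt_0_compat | exact Hpos].
Qed.
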